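(* Let $X$ be a quasi-Banach function lattice over $(\mathcal P,\mu)$. If continuous functions are dense in $N^1X$ (i.e. $C(\mathcal P)\cap N^1X$ is dense in $N^1X$), then for every $u\in N^1X$ there is a quasi-continuous function $\tilde u$ with $\tilde u=u$ $C_X$-q.e. Hence, every $u\in N^1X$ is weakly quasi-continuous.
   Context: Setting. $\mathcal P=(\mathcal P,\mathrm d,\mu)$ is a metric space with a $\sigma$-finite Borel regular measure $\mu$ (all Borel sets are $\mu$-measurable, and every $\mu$-measurable set $A$ is contained in a Borel set $D$ with $\mu(D)=\mu(A)$) such that every ball has finite positive measure. $\mathcal M(\mathcal P,\mu)$ is the set of all extended real-valued $\mu$-measurable functions on $\mathcal P$ (defined everywhere). Quasi-Banach function lattice: a linear space $X=\{u\in\mathcal M(\mathcal P,\mu):\|u\|_X<\infty\}$ given by a functional $\|\cdot\|_X:\mathcal M(\mathcal P,\mu)\to[0,\infty]$ such that: $\|u\|_X=0$ iff $u=0$ a.e.; $\|au\|_X=|a|\,\|u\|_X$ for $a\in\mathbb R$; there is a constant $c_\triangle\ge1$ (modulus of concavity) with $\|u+v\|_X\le c_\triangle(\|u\|_X+\|v\|_X)$; if $|u|\le|v|$ a.e. then $\|u\|_X\le\|v\|_X$; and (Riesz--Fischer) if $u_n\ge0$ a.e. for all $n$ then $\|\sum_{n=1}^\infty u_n\|_X\le\sum_{n=1}^\infty c_\triangle^n\|u_n\|_X$. The quasi-norm is also assumed continuous: $\|u_n-u\|_X\to0$ implies $\|u_n\|_X\to\|u\|_X$. Newtonian space. A curve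 is a non-constant continuous map $\gamma$ from a compact interval into $\mathcal P$ of finite length, parametrized by arc length $ds$ on $[0,l_\gamma]$. A Borel function $g:\mathcal P\to[0,\infty]$ is an upper gradient of $u:\mathcal P\to[-\infty,\infty]$ if $|u(\gamma(0))-u(\gamma(l_\gamma))|\le\int_\gamma g\,ds$ for every curve $\gamma$, with the convention $|(\pm\infty)-(\pm\infty)|=\infty$. Set $\|u\|_{N^1X}=\|u\|_X+\inf_g\|g\|_X$, infimum over all upper gradients $g$ of $u$, and $N^1X=\{u\in\mathcal M(\mathcal P,\mu):\|u\|_{N^1X}<\infty\}$ (a quasi-seminormed space of everywhere defined functions). Capacity. $C_X(E)=\inf\{\|u\|_{N^1X}:u\ge1\text{ on }E\}$ for $E\subset\mathcal P$. A property holds $C_X$-q.e. if the exceptional set has $C_X$-capacity zero. A function $u:\mathcal P\to[-\infty,\infty]$ is weakly quasi-continuous if for every $\varepsilon>0$ there is $E\subset\mathcal P$ with $C_X(E)<\varepsilon$ such that $u|_{\mathcal P\setminus E}$ is continuous; it is quasi-continuous if $E$ can be chosen open for every $\varepsilon>0$. A continuous function is understood to be real-valued. *)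

(* Defs.v *)
From HB Require Import structures.
From mathcomp Require Import all_boot all_order all_algebra.
From mathcomp Require Import all_classical all_reals all_analysis.
From mathcomp Require Import measurable_realfun.

Set Implicit Arguments.
Unset Strict Implicit.
Unset Printing Implicit Defensive.

Import Order.TTheory GRing.Theory Num.Theory.
Import numFieldNormedType.Exports.

Local Open Scope classical_set_scope.
Local Open Scope ring_scope.
Local Open Scope ereal_scope.

(* A metric space together with a sigma-algebra, the [measurable] sets; no
   relation between the two is assumed here, see [metric_measure_space]. *)
#[short(type="metricMeasurableType")]
HB.structure Definition MetricMeasurable (d : measure_display)
  (R : realType) := {T of Metric R T & Measurable d T}.

Definition borel_set (T : topologicalType) : set (set T) := <<s @open T >>.

(* The sigma-algebra on which [mu] lives is only assumed to contain the Borel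
   sets; it need not be complete. *)
Record metric_measure_space (d : measure_display) (R : realType)
    (P : metricMeasurableType d R) (mu : {measure set P -> \bar R}) : Prop := {
  mms_sigma_finite : sigma_finite [set: P] mu ;
  mms_borel_measurable : borel_set (T := P) `<=` measurable ;
  mms_borel_regular : forall A : set P, measurable A ->
    exists D : set P, [/\ borel_set D, A `<=` D & mu D = mu A] ;
  mms_ball : forall (x : P) (r : R), (0 < r)%R ->
    0 < mu (ball x r) /\ mu (ball x r) < +oo
}.

(* The functional is total on [P -> \bar R], but it is constrained, and will
   be used, on measurable functions only. On [\bar R], (+oo) + (-oo) = -oo; this
   convention is immaterial since functions of finite quasi-norm are finite
   almost everywhere. *)
Record quasiBanachLattice (d : measure_display) (R : realType)
    (P : metricMeasurableType d R) (mu : {measure set P -> \bar R}) := {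
  qnorm :> (P -> \bar R) -> \bar R ;
  concavity_modulus : R ;
  concavity_modulus_ge1 : (1 <= concavity_modulus)%R ;
  qnorm_ge0 : forall u : P -> \bar R, measurable_fun [set: P] u -> 0 <= qnorm u ;
  qnorm_eq0 : forall u : P -> \bar R, measurable_fun [set: P] u ->
    (qnorm u = 0 <-> {ae mu, forall x, u x = 0}) ;
  qnormZ : forall (a : R) (u : P -> \bar R), measurable_fun [set: P] u ->
    qnorm (fun x => a%:E * u x) = `|a|%:E * qnorm u ;
  qnormD : forall u v : P -> \bar R,
    measurable_fun [set: P] u -> measurable_fun [set: P] v ->
    qnorm (fun x => u x + v x) <= concavity_modulus%:E * (qnorm u + qnorm v) ;
  qnorm_le : forall u v : P -> \bar R,
    measurable_fun [set: P] u -> measurable_fun [set: P] v ->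
    {ae mu, forall x, `|u x| <= `|v x|} -> qnorm u <= qnorm v ;
  qnorm_riesz_fischer : forall u_ : nat -> P -> \bar R,
    (forall n, measurable_fun [set: P] (u_ n)) ->
    (forall n, {ae mu, forall x, 0 <= u_ n x}) ->
    qnorm (fun x => \sum_(1 <= n <oo) u_ n x) <=
      \sum_(1 <= n <oo) (concavity_modulus ^+ n)%:E * qnorm (u_ n) ;
  qnorm_continuous : forall (u_ : nat -> P -> \bar R) (u : P -> \bar R),
    (forall n, measurable_fun [set: P] (u_ n)) -> measurable_fun [set: P] u ->
    qnorm (fun x => u_ n x - u x) @[n --> \oo] --> 0 ->
    qnorm (u_ n) @[n --> \oo] --> qnorm u
}.

Definition curve_length (R : realType) (P : metricType R) (a b : R)
    (gamma : R -> P) : \bar R :=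
  ereal_sup [set (\sum_(0 <= n < size s)
      mdist (gamma (nth b (a :: s) n)) (gamma (nth b (a :: s) n.+1)))%:E |
    s in itv_partition a b].

(* Only the values of [gamma] on [a, b] are relevant. *)
Definition is_curve (R : realType) (P : metricType R) (a b : R)
    (gamma : R -> P) : Prop :=
  [/\ (a <= b)%R,
      {within `[a, b], continuous gamma},
      exists s t, [/\ s \in `[a, b], t \in `[a, b] & gamma s <> gamma t] &
      curve_length a b gamma < +oo].

Definition arc_length_curve (R : realType) (P : metricType R) (l : R)
    (gamma : R -> P) : Prop :=
  is_curve 0 l gamma /\
  forall t : R, t \in `[0%R, l] -> curve_length 0 t gamma = t%:E.

Definition borel_fun (R : realType) (T : topologicalType)
    (g : T -> \bar R) : Prop :=
  forall B : set (\bar R), measurable B -> borel_set (g @^-1` B).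

(* In [\bar R], (+oo) - (+oo) = (-oo) - (-oo) = -oo, whose absolute value is
   +oo, as the definition of an upper gradient requires. *)
Definition upper_gradient (R : realType) (P : metricType R)
    (g u : P -> \bar R) : Prop :=
  [/\ borel_fun g,
      forall x, 0 <= g x &
      forall (l : R) (gamma : R -> P), arc_length_curve l gamma ->
        `|u (gamma 0%R) - u (gamma l)| <=
          \int[lebesgue_measure]_(s in `[0%R, l]) g (gamma s)].

Section newtonian.
Context (d : measure_display) (R : realType) (P : metricMeasurableType d R).
Context (mu : {measure set P -> \bar R}) (X : quasiBanachLattice mu).

Definition N1norm (u : P -> \bar R) : \bar R :=
  X u + ereal_inf [set X g | g in [set g | upper_gradient g u]].

Definition N1 : set (P -> \bar R) :=
  [set u | measurable_fun [set: P] u /\ N1norm u < +oo].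

Definition capacity (E : set P) : \bar R :=
  ereal_inf [set N1norm u | u in
    [set u | measurable_fun [set: P] u /\ forall x, E x -> 1 <= u x]].

Definition quasi_everywhere (Q : P -> Prop) : Prop :=
  capacity [set x | ~ Q x] = 0.

(* Continuous functions are real-valued, hence the finiteness condition. *)
Definition continuous_restriction (u : P -> \bar R) (A : set P) : Prop :=
  (forall x, A x -> u x \is a fin_num) /\ {within A, continuous u}.

Definition weakly_quasi_continuous (u : P -> \bar R) : Prop :=
  forall e : R, (0 < e)%R -> exists E : set P,
    capacity E < e%:E /\ continuous_restriction u (~` E).

Definition quasi_continuous (u : P -> \bar R) : Prop :=
  forall e : R, (0 < e)%R -> exists E : set P,
    [/\ open E, capacity E < e%:E & continuous_restriction u (~` E)].

Definition continuous_dense_in_N1 : Prop :=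
  forall u, N1 u -> forall e : R, (0 < e)%R -> exists v : P -> R,
    [/\ continuous v, N1 (EFin \o v) &
        N1norm (fun x => u x - (v x)%:E) < e%:E].

End newtonian.

(* Main.v *)
(** Pick continuous [v n] with [u - v n] of N1-norm less than [(4c)^-n], where
    [c] is the modulus of concavity. The set [far k] where [|u - v n| >= 2^-n]
    for some [n > k] has capacity at most [2^-k]: the function
    [min 1 (\sum_n 2^n |u - v n|)] is at least 1 on it, and the correspondingly
    weighted sum of upper gradients of the [u - v n] is an upper gradient of it,
    so that the Riesz-Fischer inequality applies. Off [far k] the sequence [v]
    converges to [u]. If two consecutive [v n] differ by more than [2 * 2^-n] at
    a point, then [u] is far from one of them there, so the set of such points
    with [n > k] is a subset of [far k], which moreover is open; off it the
    convergence of [v] is uniform and the limit is continuous. *)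

Require Import Defs.
From mathcomp Require Import all_boot all_order all_algebra.
From mathcomp Require Import all_classical all_reals all_analysis.
From mathcomp Require Import measurable_realfun lra.

Set Implicit Arguments.
Unset Strict Implicit.
Unset Printing Implicit Defensive.

Import Order.TTheory GRing.Theory Num.Theory.
Import numFieldNormedType.Exports.

Local Open Scope classical_set_scope.
Local Open Scope ring_scope.

(** * Borel measurability, and series of nonnegative functions *)

Local Notation borel_type T := (g_sigma_algebraType (@open T)).

(** [measurable] on the underlying space may contain more than the Borel sets. The copy [borel_type]
    carries exactly the Borel sets, so general facts on measurable functions apply to
    [borel_fun]. *)
Lemma borel_funP (R : realType) (T : ptopologicalType) (g : T -> \bar R) :
  borel_fun g <-> measurable_fun [set: borel_type T] (g : borel_type T -> \bar R).
Proof.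
split=> [bg _ B mB|mg B mB]; first by rewrite setTI; exact: bg.
by have := mg measurableT B mB; rewrite setTI.
Qed.

Lemma nneseries_measurable (d : measure_display) (T : measurableType d)
    (R : realType) (D : set T) (h : nat -> T -> \bar R) (N : nat) :
  (forall n x, 0 <= h n x)%E -> (forall n, measurable_fun D (h n)) ->
  measurable_fun D (fun x => \sum_(N <= n <oo) h n x)%E.
Proof.
move=> h0 mh.
under eq_fun do rewrite eseries_cond.
by apply: ge0_emeasurable_sum => // n x _ _.
Qed.

Lemma integral_nneseries_from (d : measure_display) (T : measurableType d)
    (R : realType) (mu : {measure set T -> \bar R}) (D : set T)
    (h : nat -> T -> \bar R) (N : nat) :
  measurable D ->
  (forall n x, 0 <= h n x)%E -> (forall n, measurable_fun D (h n)) ->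
  (\int[mu]_(x in D) \sum_(N <= n <oo) h n x =
   \sum_(N <= n <oo) \int[mu]_(x in D) h n x)%E.
Proof.
move=> mD h0 mh.
under eq_integral do rewrite -nneseries_addn//.
rewrite integral_nneseries// -[RHS]nneseries_addn// => n.
by apply: integral_ge0.
Qed.

(** Composed with a Borel function such as an upper gradient, this makes the integrand along a curve
    measurable. *)
Lemma within_continuous_borel (R : realType) (P : ptopologicalType) (D : set R)
    (gamma : R -> P) : measurable D -> {within D, continuous gamma} ->
  measurable_fun D (gamma : R -> borel_type P).
Proof.
move=> mD /continuousP cg.
apply: (@measurability _ _ _ (borel_type P) D gamma (@open P)) => //.
move=> _ [U oU <-].
by apply: open_measurable_subspace => //; exact: cg.
Qed.

(** * Distances between extended reals *)

Lemma lee_abseD_dist (R : realDomainType) (x y : \bar R) :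
  (`|x| <= `|y| + `|x - y|)%E.
Proof.
case: x y => [x||] [y||] //=; rewrite ?leey ?leNye//.
by rewrite -EFinD lee_fin -lerBlDl lerB_dist.
Qed.

(** Truncation at 1 is 1-Lipschitz. Closeness of [x] and [y] is stated additively because [x - y] is
    of no use when both are [+oo]; in that case the truncations are both 1. *)
Lemma lee_dist_mine1 (R : realFieldType) (x y z : \bar R) :
  (0 <= x -> 0 <= y -> 0 <= z -> x <= y + z -> y <= x + z ->
  `|mine 1 x - mine 1 y| <= z)%E.
Proof.
case: z => [z||] //=; rewrite ?leey//.
case: x y => [x||] [y||] //=; rewrite ?lee_fin/= => x0 y0 z0 xy yx.
- rewrite -!EFin_min -EFinB lee_fin ler_norml.
  by rewrite /Num.min; case: ltP => ?; case: ltP => ?; apply/andP; split; lra.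
- by rewrite min_l ?leey// -EFinB subrr abse0.
Qed.

Lemma abse_distZ (R : realDomainType) (a : R) (x y : \bar R) : 0 < a ->
  (`|a%:E * x - a%:E * y| = a%:E * `|x - y|)%E.
Proof.
move=> a0; case: x y => [x||] [y||];
  rewrite ?gt0_muley ?gt0_muleNy ?lte_fin//= -?EFinB ?gt0_muley ?lte_fin//.
by rewrite -mulrBr normrM gtr0_norm.
Qed.

Lemma abse_distC (R : realDomainType) (x y : \bar R) :
  (`|x - y| = `|y - x|)%E.
Proof. by case: x y => [x||] [y||] //=; rewrite distrC. Qed.

Lemma lee_nneseries_term (R : realType) (h : nat -> \bar R) (N n : nat) :
  (forall n, 0 <= h n)%E -> (N <= n)%N -> (h n <= \sum_(N <= i <oo) h i)%E.
Proof.
move=> h0 Nn; apply: le_trans (nneseries_lim_ge n.+1 _) => //.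
by rewrite big_nat_recr//= leeDr// sume_ge0.
Qed.

(** * Sequences with geometrically decreasing steps *)

Lemma lt_half_expn (R : realType) (b e : R) (k : nat) : 0 < e ->
  exists2 n, (k < n)%N & b * 2^-1 ^+ n < e.
Proof.
move=> e0; have : geometric b (2^-1 : R) @ \oo --> 0.
  by apply: cvg_geometric; rewrite ger0_norm ?invr_ge0// invf_lt1// ltr1n.
move=> /cvgrPdist_lt /(_ e e0)[N _ NP]; exists (maxn N k.+1).
  exact: leq_maxr.
have := NP _ (leq_maxl N k.+1); rewrite sub0r normrN; apply: le_lt_trans.
exact: ler_norm.
Qed.

(** The steps from [n] on are dominated by a geometric series with sum [4 * 2^-1 ^+ n], so the
    sequence is Cauchy. *)
Lemma cvg_half_expn (R : realType) (a : nat -> R) (k : nat) :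
  (forall n, (k < n)%N -> `|a n.+1 - a n| <= 2 * 2^-1 ^+ n) ->
  cvgn a /\ forall n, (k < n)%N -> `|limn a - a n| <= 4 * 2^-1 ^+ n.
Proof.
move=> ha.
(* The bound is the exact partial sum of the series; without the subtracted term the induction on
   [m] would not close. *)
have ham n m : (k < n)%N ->
    `|a (n + m)%N - a n| <= 4 * 2^-1 ^+ n - 4 * 2^-1 ^+ (n + m).
  move=> kn; elim: m => [|m IH]; first by rewrite addn0 !subrr normr0.
  have := ha (n + m)%N (leq_trans kn (leq_addr _ _)).
  rewrite addnS exprS => hm.
  have := ler_distD (a (n + m)%N) (a (n + m).+1) (a n).
  lra.
have hab n m : (k < n)%N -> (n <= m)%N -> `|a m - a n| <= 4 * 2^-1 ^+ n.
  move=> kn nm; have := ham n (m - n)%N kn; rewrite subnKC//.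
  move=> /le_trans; apply; rewrite gerBl mulr_ge0// exprn_ge0// invr_ge0//.
have ca : cvgn a.
  apply/cauchy_cvgP/cauchy_exP => e e0.
  have [n kn ne] := lt_half_expn 4 k e0.
  exists (a n), n => // m /= nm.
  by rewrite -ball_normE/= distrC; apply: le_lt_trans ne; exact: hab.
split=> // n kn.
have hl : `|a m - a n| @[m --> \oo] --> `|limn a - a n|.
  by apply: cvg_norm; apply: cvgB => //; exact: cvg_cst.
rewrite -(cvg_lim _ hl)//; apply: limr_le; first by apply/cvg_ex; eexists; exact: hl.
by exists n => // m /= nm; exact: hab.
Qed.

(** On [A] the convergence is uniform: [f x] and [f t] are compared through a single continuous
    [v n]. *)
Lemma within_continuous_half_expn (R : realType) (T : topologicalType)
    (A : set T) (v : nat -> T -> R) (f : T -> R) (k : nat) :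
  (forall n, continuous (v n)) ->
  (forall x n, A x -> (k < n)%N -> `|f x - v n x| <= 4 * 2^-1 ^+ n) ->
  {within A, continuous f}.
Proof.
move=> cv fv; apply/subspace_continuousP => x Ax; apply/cvgrPdist_lt => e e0.
have e40 : 0 < e / 4 by rewrite divr_gt0.
have [n kn ne] := lt_half_expn 4 k e40.
have vx : \forall t \near within A (nbhs x), `|v n x - v n t| < e / 4.
  by apply: cvg_within; have /cvgrPdist_lt := cv n x; exact.
near=> t.
have At : A t by near: t; exact: withinT.
have vt : `|v n x - v n t| < e / 4 by near: t.
have fx := fv x n Ax kn; have := fv t n At kn; rewrite distrC => ft.
have h1 := ler_distD (v n x) (f x) (f t).
have h2 := ler_distD (v n t) (v n x) (f t).
lra.
Unshelve. all: by end_near. Qed.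

Lemma nneseries_half_expn (R : realType) (k : nat) :
  (\sum_(1 <= n <oo) (2^-1 ^+ (k + n) : R)%:E = (2^-1 ^+ k)%:E)%E.
Proof.
rewrite -nneseries_addn; last first.
  by move=> n; rewrite lee_fin exprn_ge0// invr_ge0.
have := @cvg_geometric_eseries_half R 1 k.
move=> /(cvg_lim _); rewrite div1r -exprVn => <-//.
congr (limn _); apply/funext => m; apply: eq_bigr => i _.
by rewrite div1r natrX exprVn addnC addn1 addSnnS.
Qed.

(** * Quasi-norm, upper gradients and capacity *)

Section capacity_estimates.
Context (d : measure_display) (R : realType) (P : metricMeasurableType d R).
Context (mu : {measure set P -> \bar R}) (X : quasiBanachLattice mu).
Context (borelP : borel_set (T := P) `<=` measurable).
Local Open Scope ereal_scope.

Let c := concavity_modulus X.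

Lemma borel_fun_measurable (g : P -> \bar R) :
  borel_fun g -> measurable_fun [set: P] g.
Proof. by move=> bg _ B mB; rewrite setTI; apply: borelP; exact: bg. Qed.

Lemma upper_gradient_measurable (g u : P -> \bar R) :
  upper_gradient g u -> measurable_fun [set: P] g.
Proof. by case=> bg _ _; exact: borel_fun_measurable. Qed.

Lemma le_qnorm (u v : P -> \bar R) :
  measurable_fun [set: P] u -> measurable_fun [set: P] v ->
  (forall x, `|u x| <= `|v x|) -> X u <= X v.
Proof. by move=> meas_u mv uv; apply: qnorm_le => //; exact: aeW. Qed.

Lemma N1norm_ge0 (u : P -> \bar R) :
  measurable_fun [set: P] u -> 0 <= N1norm X u.
Proof.
move=> meas_u; apply: adde_ge0; first exact: qnorm_ge0.
apply: le_ereal_inf_tmp => _ [g ug <-].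
by apply: qnorm_ge0; exact: upper_gradient_measurable ug.
Qed.

Lemma capacity_ge0 (E : set P) : 0 <= capacity X E.
Proof. by apply: le_ereal_inf_tmp => _ [u [meas_u _] <-]; exact: N1norm_ge0. Qed.

Lemma capacity_mono (E F : set P) : E `<=` F -> capacity X E <= capacity X F.
Proof.
move=> EF; apply: ereal_inf_le_tmp => _ [u [meas_u u1] <-].
by exists u => //; split=> // x /EF; exact: u1.
Qed.

(** [X u] is finite, so it can be subtracted; what remains strictly exceeds the infimum over upper
    gradients, hence also [X g] for some [g]. *)
Lemma N1norm_lt_upper_gradient (u : P -> \bar R) (e : R) :
  measurable_fun [set: P] u -> N1norm X u < e%:E ->
  exists2 g, upper_gradient g u & X u + X g < e%:E.
Proof.
move=> meas_u ue.
have Xu0 : 0 <= X u by exact: qnorm_ge0.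
have I0 : 0 <= ereal_inf [set X g | g in [set g | upper_gradient g u]].
  apply: le_ereal_inf_tmp => _ [g ug <-].
  by apply: qnorm_ge0; exact: upper_gradient_measurable ug.
have fXu : X u \is a fin_num.
  rewrite ge0_fin_numE//; apply: le_lt_trans (ltry e).
  by apply: le_trans (ltW ue); rewrite /N1norm leeDl.
move: ue; rewrite /N1norm addeC -lteBrDr// => /ereal_inf_lt[_ [g ug <-] gu].
by exists g => //; rewrite addeC -lteBrDr.
Qed.

Lemma upper_gradientZ (a : R) (g u : P -> \bar R) : (0 < a)%R ->
  upper_gradient g u ->
  upper_gradient (fun x => a%:E * g x) (fun x => a%:E * u x).
Proof.
move=> a0 [/borel_funP bg g0 ug]; split.
- by apply/borel_funP; exact: measurable_funeM.
- by move=> x; rewrite mule_ge0// lee_fin ltW.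
- move=> l gamma lg; have [[_ cg _ _] _] := lg.
  have mgg : measurable_fun `[0%R, l] (g \o gamma).
    apply: (measurableT_comp (T2 := borel_type P)) => //.
    exact: within_continuous_borel.
  rewrite ge0_integralZl//; last by rewrite lee_fin ltW.
  rewrite abse_distZ// lee_pmul2l//.
  exact: ug.
Qed.

Lemma N1normZ_lt (a e : R) (u : P -> \bar R) : (0 < a)%R ->
  measurable_fun [set: P] u -> N1norm X u < e%:E ->
  N1norm X (fun x => a%:E * u x) < (a * e)%:E.
Proof.
move=> a0 meas_u ue; have [g ug Xe] := N1norm_lt_upper_gradient meas_u ue.
have mg := upper_gradient_measurable ug.
apply: (@le_lt_trans _ _ (a%:E * (X u + X g))); last first.
  by rewrite EFinM lte_pmul2l// lte_fin.
rewrite ge0_muleDr ?qnorm_ge0// /N1norm qnormZ// gtr0_norm// leeD2l//.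
have -> : a%:E * X g = X (fun x => a%:E * g x) by rewrite qnormZ// gtr0_norm.
by apply: ereal_inf_lbound; exists (fun x => a%:E * g x) => //;
  exact: upper_gradientZ.
Qed.

(** * Countable sums and the capacity of superlevel sets *)

Lemma nneseries_dist (w : nat -> P -> \bar R) (h : nat -> \bar R) (x y : P) :
  (forall n, `|w n x - w n y| <= h n) ->
  \sum_(1 <= n <oo) `|w n x| <=
    \sum_(1 <= n <oo) `|w n y| + \sum_(1 <= n <oo) h n.
Proof.
move=> wh; have h0 n : 0 <= h n by exact: le_trans (wh n).
rewrite -nneseriesD//; apply: lee_nneseries => // n _.
by apply: le_trans (lee_abseD_dist _ (w n y)) _; exact: leeD2l.
Qed.

(* Two infinite values of the bare sum may violate the upper gradient
   inequality, as [+oo - +oo] counts as [+oo]; hence the truncation at 1. *)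
Lemma upper_gradient_mine_nneseries (w g : nat -> P -> \bar R) :
  (forall n, upper_gradient (g n) (w n)) ->
  upper_gradient (fun x => \sum_(1 <= n <oo) g n x)
    (fun x => mine 1 (\sum_(1 <= n <oo) `|w n x|)).
Proof.
move=> wg; have g0 n x : 0 <= g n x by have [_ + _] := wg n; exact.
have bg n : measurable_fun [set: borel_type P] (g n).
  by apply/borel_funP; have [] := wg n.
split.
- by apply/borel_funP; exact: nneseries_measurable.
- by move=> x; exact: nneseries_ge0.
- move=> l gamma lg; have [[_ cg _ _] _] := lg.
  have mgg n : measurable_fun `[0%R, l] (g n \o gamma).
    apply: (measurableT_comp (T2 := borel_type P)) => //.
    exact: within_continuous_borel.
  rewrite integral_nneseries_from//.
  have dist n : `|w n (gamma 0%R) - w n (gamma l)| <=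
      \int[lebesgue_measure]_(s in `[0%R, l]) g n (gamma s).
    by have [_ _] := wg n; exact.
  apply: lee_dist_mine1; try by apply: nneseries_ge0 => // n _ _.
  + by apply: nneseries_ge0 => // n _ _; exact: integral_ge0.
  + exact: nneseries_dist.
  + by apply: nneseries_dist => n; rewrite abse_distC.
Qed.

(** The truncated sum of the [|w n|] is admissible for this set. Riesz-Fischer, used once for the
    [|w n|] and once for their upper gradients, produces the weights [c ^+ n]. *)
Lemma capacity_le_nneseries (w : nat -> P -> \bar R) (e : nat -> R) :
  (forall n, measurable_fun [set: P] (w n)) ->
  (forall n, N1norm X (w n) < (e n)%:E) ->
  capacity X [set x | exists2 n, (0 < n)%N & 1 <= `|w n x|] <=
    \sum_(1 <= n <oo) (c ^+ n * e n)%:E.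
Proof.
move=> mw we.
have [g wg Xg] : exists2 g : nat -> P -> \bar R,
    forall n, upper_gradient (g n) (w n) &
    forall n, X (w n) + X (g n) < (e n)%:E.
  have /choice[g gP] : forall n, exists g, upper_gradient g (w n) /\
      X (w n) + X g < (e n)%:E.
    by move=> n; have [g] := N1norm_lt_upper_gradient (mw n) (we n); exists g.
  by exists g => n; have [] := gP n.
have mg n := upper_gradient_measurable (wg n).
have g0 n x : 0 <= g n x by have [_ + _] := wg n; exact.
have maw n : measurable_fun [set: P] (fun x => `|w n x|).
  exact: measurableT_comp.
pose S x := \sum_(1 <= n <oo) `|w n x|.
have mS : measurable_fun [set: P] S by exact: nneseries_measurable.
have S0 x : 0 <= S x by exact: nneseries_ge0.
have mT : measurable_fun [set: P] (fun x => mine 1 (S x)).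
  exact: measurable_mine.
have c0 n : (0 <= c ^+ n)%R.
  by rewrite exprn_ge0// (le_trans _ (concavity_modulus_ge1 X)).
apply: (@le_trans _ _ (N1norm X (fun x => mine 1 (S x)))).
  apply: ereal_inf_lbound; exists (fun x => mine 1 (S x)) => //; split=> // x.
  move=> [n n0 wn]; rewrite le_min lexx/= (le_trans wn)//.
  exact: lee_nneseries_term.
apply: (@le_trans _ _ (\sum_(1 <= n <oo) (c ^+ n)%:E * X (w n) +
                       \sum_(1 <= n <oo) (c ^+ n)%:E * X (g n))).
  apply: leeD.
    apply: (@le_trans _ _ (X S)).
      apply: le_qnorm => // x.
      rewrite !gee0_abs// ?ge_min ?lexx ?orbT// le_min S0 andbT.
      by rewrite lee_fin.
    apply: (le_trans (qnorm_riesz_fischer _ _ _)) => //.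
      by move=> n; apply: aeW => x.
    apply: lee_nneseries => n *; first by rewrite mule_ge0 ?lee_fin ?qnorm_ge0.
    rewrite lee_wpmul2l ?lee_fin//.
    by apply: le_qnorm => // x; rewrite abse_id.
  apply: (@le_trans _ _ (X (fun x => \sum_(1 <= n <oo) g n x))).
    apply: ereal_inf_lbound; exists (fun x => \sum_(1 <= n <oo) g n x) => //.
    exact: upper_gradient_mine_nneseries.
  apply: qnorm_riesz_fischer => // n; exact: aeW.
rewrite -nneseriesD; last 2 first.
  by move=> *; rewrite mule_ge0 ?lee_fin ?qnorm_ge0.
  by move=> *; rewrite mule_ge0 ?lee_fin ?qnorm_ge0.
apply: lee_nneseries => n *.
  by rewrite adde_ge0// mule_ge0 ?lee_fin ?qnorm_ge0.
rewrite -ge0_muleDr ?qnorm_ge0// EFinM lee_wpmul2l ?lee_fin//.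
exact: ltW.
Qed.

(** * The approximating sequence, its exceptional sets and its limit *)

Context (u : P -> \bar R) (meas_u : measurable_fun [set: P] u).
Context (v : nat -> P -> R) (cv : forall n, continuous (v n)).
Context (mv : forall n, measurable_fun [set: P] (EFin \o v n)).
Context (uv : forall n,
  N1norm X (fun x => u x - (v n x)%:E) < ((4 * c)^-1 ^+ n)%:E).

Let far (k : nat) : set P := [set x |
  exists2 n, (k < n)%N & (2^-1 ^+ n)%:E <= `|u x - (v n x)%:E|].

(** Only the continuous [v n] and a strict inequality occur here, which makes the set open. *)
Let jump (k : nat) : set P := [set x |
  exists2 n, (k < n)%N & (2 * 2^-1 ^+ n < `|v n.+1 x - v n x|)%R].

Let half_gt0 n : (0 < 2^-1 ^+ n :> R)%R.
Proof. by rewrite exprn_gt0// invr_gt0. Qed.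

(** In the rate [(4 * c)^-1], one factor 2 absorbs the weight of [w], the other leaves a summable
    geometric series, and [c] pays for Riesz-Fischer. *)
Let capacity_far k : capacity X (far k) <= (2^-1 ^+ k)%:E.
Proof.
have c1 : (1 <= c)%R := concavity_modulus_ge1 X.
have c0 : (0 < c)%R by exact: lt_le_trans c1.
(* The shift by [k] matches the series, which starts at 1, with the indices above [k]. *)
pose w n x := (2 ^+ (k + n))%:E * (u x - (v (k + n)%N x)%:E).
have muw n : measurable_fun [set: P] (fun x => u x - (v n x)%:E).
  by apply: emeasurable_funB => //; exact: (mv n).
have mw n : measurable_fun [set: P] (w n) by exact: measurable_funeM.
have we n : N1norm X (w n) < (2 ^+ (k + n) * (4 * c)^-1 ^+ (k + n))%:E.
  by apply: N1normZ_lt; rewrite ?exprn_gt0.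
have sub : far k `<=` [set x | exists2 n, (0 < n)%N & 1 <= `|w n x|].
  move=> x [n kn uvn]; exists (n - k)%N; first by rewrite subn_gt0.
  rewrite /w subnKC; last exact: ltnW.
  rewrite abseM gee0_abs ?lee_fin ?exprn_ge0//.
  have -> : 1 = (2 ^+ n)%:E * (2^-1 ^+ n)%:E :> \bar R.
    by rewrite -EFinM -exprMn divff// expr1n.
  by rewrite lee_wpmul2l// lee_fin exprn_ge0.
apply: le_trans (capacity_mono sub) _.
apply: le_trans (capacity_le_nneseries mw we) _.
rewrite -nneseries_half_expn; apply: lee_nneseries => n *.
  by rewrite lee_fin !mulr_ge0// ?exprn_ge0 ?invr_ge0 ?mulr_ge0// ltW.
rewrite lee_fin -exprMn.
have -> : (2 * (4 * c)^-1 = 2^-1 * c^-1 :> R)%R.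
  rewrite invfM mulrA; congr (_ * _)%R.
  by rewrite (_ : 4 = 2 * 2 :> R)%R ?invfM ?mulrA ?divff ?mul1r// -natrM.
(* The decay [c^-1 ^+ (k + n)] beats the weight [c ^+ n]; the surplus [c^-1 ^+ k] is at most 1
   because [1 <= c]. *)
rewrite exprMn mulrCA ger_pMr//.
rewrite exprD mulrCA -exprMn divff ?gt_eqF// expr1n mulr1.
by rewrite exprn_ile1// ?invr_ge0 ?invf_le1// ltW.
Qed.

Let jump_sub_far k : jump k `<=` far k.
Proof.
move=> x [n kn hn]; apply: contrapT => nfar.
have near_ m : (k < m)%N -> `|u x - (v m x)%:E| < (2^-1 ^+ m)%:E.
  by move=> km; rewrite ltNge; apply/negP => h; apply: nfar; exists m.
have := near_ n kn; have := near_ n.+1 (ltnW kn); move: hn.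
(* An infinite [u x] would be at distance [+oo] from [v n x]. For finite [u x] the step is below
   [2^-1 ^+ n + 2^-1 ^+ n.+1], which is less than [2 * 2^-1 ^+ n]. *)
case: (u x) => [r||]//=; rewrite !lte_fin exprS => h1 h2 h3.
have := ler_distD r (v n.+1 x) (v n x).
rewrite (distrC (v n.+1 x) r).
have := half_gt0 n.
lra.
Qed.

Let open_jump k : open (jump k).
Proof.
rewrite (_ : jump k = \bigcup_(n in [set n | (k < n)%N])
    (fun x => `|v n.+1 x - v n x|)%R @^-1` [set r | 2 * 2^-1 ^+ n < r]%R).
  apply: bigcup_open => n _; apply: open_comp; last exact: open_gt.
  by move=> x _; apply: cvg_norm; apply: cvgB; exact: cv.
by apply/seteqP; split=> x [n kn hn]; exists n.
Qed.

(** One function serves all [k]. Where the sequence diverges [limn] is a default value; such points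
    lie in every [jump k], hence in a set of capacity zero. *)
Let ut (x : P) : R := limn (v ^~ x).

Let njump_dist k x : ~ jump k x -> cvgn (v ^~ x) /\
  forall n, (k < n)%N -> (`|ut x - v n x| <= 4 * 2^-1 ^+ n)%R.
Proof.
move=> nj; apply: cvg_half_expn => n kn.
by rewrite leNgt; apply/negP => h; apply: nj; exists n.
Qed.

Let ut_continuous k : {within ~` jump k, continuous ut}.
Proof.
apply: (@within_continuous_half_expn _ _ _ v _ k) => // x n nj kn.
by have [_] := njump_dist nj; exact.
Qed.

Let ut_eq k x : ~ far k x -> (ut x)%:E = u x.
Proof.
move=> nfar.
have nu m : (k < m)%N -> `|u x - (v m x)%:E| < (2^-1 ^+ m)%:E.
  by move=> km; rewrite ltNge; apply/negP => h; apply: nfar; exists m.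
(* The index [k.+1] alone already forces [u x] to be finite. *)
move: (nu _ (ltnSn k)); case: (u x) nu => [r||]//= nu _.
congr EFin; apply: cvg_lim => //; apply/cvgrPdist_lt => e e0.
have [n kn ne] := lt_half_expn 1 k e0.
exists n => // m /= nm.
have := nu m (leq_trans kn nm); rewrite lte_fin => /lt_trans; apply.
apply: le_lt_trans ne; rewrite mul1r.
by rewrite ler_wiXn2l// ?invr_ge0 ?invf_le1 ?ler1n.
Qed.

(** The exceptional set lies in [far k] for every [k], and these capacities tend to 0. *)
Let ut_qe : quasi_everywhere X (fun x => (ut x)%:E = u x).
Proof.
apply/eqP; rewrite eq_le capacity_ge0 andbT; apply/lee_addgt0Pr => e e0.
rewrite add0e; have [k _ ke] := lt_half_expn 1 0 e0.
apply: le_trans (capacity_mono (F := far k) _) _.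
  by move=> x /= ne; apply: contrapT => /ut_eq.
apply: le_trans (capacity_far k) _.
by rewrite lee_fin ltW// -(mul1r (_ ^+ _)%R).
Qed.

Let EFin_ut_continuous (A : set P) : {within A, continuous ut} ->
  continuous_restriction (EFin \o ut) A.
Proof.
move=> cut; split=> // x; apply: cvg_EFin; first by near=> y.
exact: cut.
Unshelve. all: by end_near. Qed.

Lemma quasi_continuous_representative :
  (exists ut : P -> \bar R,
    quasi_continuous X ut /\ quasi_everywhere X (fun x => ut x = u x)) /\
  weakly_quasi_continuous X u.
Proof.
have small e : (0 < e)%R -> exists k, capacity X (far k) < e%:E.
  move=> e0; have [k _ ke] := lt_half_expn 1 0 e0; exists k.
  by apply: le_lt_trans (capacity_far k) _; rewrite lte_fin -(mul1r (_ ^+ _)%R).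
split.
- exists (EFin \o ut); split=> // e /small[k ke]; exists (jump k); split=> //.
    by apply: le_lt_trans ke; exact: capacity_mono.
  by apply: EFin_ut_continuous; exact: ut_continuous.
(* For [u] itself the larger set [far k] is removed: off it [u] equals [ut], which is continuous
   there since [jump k] is removed as well. *)
- move=> e /small[k ke]; exists (far k); split=> //.
  have cut : {within ~` far k, continuous ut}.
    by apply: continuous_subspaceW (@ut_continuous k); exact: subsetC.
  have [_ cEut] := EFin_ut_continuous cut.
  split=> [x /ut_eq <-//|].
  apply: subspace_eq_continuous cEut => x; rewrite inE => nx.
  exact: ut_eq nx.
Qed.

End capacity_estimates.

(** * Choice of the approximating sequence by density *)

Theorem proposition4p5 (d : measure_display) (R : realType)
    (P : metricMeasurableType d R) (mu : {measure set P -> \bar R})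
    (hP : metric_measure_space mu) (X : quasiBanachLattice mu)
    (hdense : continuous_dense_in_N1 X) (u : P -> \bar R) (hu : N1 X u) :
  (exists ut : P -> \bar R,
      quasi_continuous X ut /\ quasi_everywhere X (fun x => ut x = u x)) /\
  weakly_quasi_continuous X u.
Proof.
have c0 : 0 < concavity_modulus X by exact: lt_le_trans (concavity_modulus_ge1 X).
have e0 n : 0 < (4 * concavity_modulus X)^-1 ^+ n.
  by rewrite exprn_gt0// invr_gt0 mulr_gt0.
have /choice[v vP] := fun n => hdense u hu _ (e0 n).
exact: (quasi_continuous_representative (mms_borel_measurable hP) hu.1
  (fun n => let: And3 cv _ _ := vP n in cv)
  (fun n => let: And3 _ Nv _ := vP n in Nv.1)
  (fun n => let: And3 _ _ uv := vP n in uv)).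
Qed.
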